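(* Let $G$ be a finite group, $\Bbbk$ an algebraically closed field of characteristic $p$, and $P$ a Sylow-$p$-subgroup of $G$ (taken to be the trivial group if $p=0$ or $p$ does not divide $|G|$). Then $\delta(G)=|P|$.
   Context: A $G$-module is a finite dimensional representation $V$ of $G$ over $\Bbbk$. $\Bbbk[V]$ is the ring of polynomial functions $V\to\Bbbk$, with action $(g\cdot f)(v)=f(g^{-1}v)$, and $\Bbbk[V]^G$ is its graded subring of invariants. $\Bbbk[V]^G_{\le d}$ is the set of invariants of degree at most $d$ (including $0$). For $S\subseteq\Bbbk[V]$, $S_+$ denotes the set of elements of $S$ with constant term zero. The nullcone is $\mathcal{N}_{G,V}=\{v\in V : f(v)=0 \text{ for all } f\in\Bbbk[V]^G_+\}$. A subset $S\subseteq\Bbbk[V]^G$ is a $\delta$-set if for all $v\in V^G\setminus\mathcal{N}_{G,V}$ there is $f\in S_+$ with $f(v)\neq0$. Then $\delta(G,V)=\min\{d\ge0 : \Bbbk[V]^G_{\le d}\text{ is a }\delta\text{-set}\}$ and $\delta(G)=\sup\{\delta(G,V) : V\text{ a }G\text{-module}\}$. (For finite $G$, $\mathcal{N}_{G,V}=\{0\}$.) *)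

(* Defs.v *)
From HB Require Import structures.
From mathcomp Require Import all_boot all_order all_algebra all_fingroup.
From mathcomp Require Import all_solvable all_character.
From mathcomp Require Import boolp classical_sets.
From mathcomp Require Import mpoly.

Set Implicit Arguments.
Unset Strict Implicit.
Unset Printing Implicit Defensive.

Import GRing.Theory.

Local Open Scope classical_set_scope.
Local Open Scope ring_scope.

Definition has_characteristic (R : nzRingType) (p : nat) : Prop :=
  (p = 0%N /\ [pchar R] =i pred0) \/ p \in [pchar R].

(* For p = 0, or p not dividing #|G|, [p.-Sylow(G) P] forces P to be trivial. *)
Lemma pHall0 (gT : finGroupType) (G P : {group gT}) :
  (0.-Sylow(G) P)%g = (P :==: 1%g).
Proof.
have pi0 m : (0 < m)%N -> 0%N.-nat m = (m == 1%N).
  move=> m0; apply/idP/eqP => [|->]; last by [].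
  move=> /pnatP-/(_ m0) h; apply/eqP; rewrite eqn_leq m0 andbT leqNgt.
  apply/negP => m1; have := h _ (pdiv_prime m1) (pdiv_dvd m).
  by rewrite inE => /eqP e; have := pdiv_prime m1; rewrite e.
apply/idP/eqP => [/and3P[_ + _]|P1].
  by rewrite /pgroup pi0 ?cardG_gt0 // => /eqP/card1_trivg.
rewrite /pHall P1 sub1G pgroup1 /=; apply/pnatP; first exact: indexg_gt0.
by move=> q q_pr _; rewrite !inE -lt0n prime_gt0.
Qed.

Lemma pHall_dvdnN (gT : finGroupType) (G P : {group gT}) (p : nat) :
  prime p -> ~~ (p %| #|G|)%N -> (p.-Sylow(G) P)%g -> P :=: 1%g.
Proof.
move=> p_pr pG sylP; apply: card1_trivg; rewrite (card_Hall sylP).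
by apply: part_p'nat; rewrite p'natE.
Qed.

(* A G-module of dimension n is the space 'cV[k]_n on which g acts by
   [v |-> rG g *m v]; this is a left action.  As k is infinite, k[V] is
   identified with {mpoly k[n]}, the i-th variable being the i-th coordinate. *)
Section Module.
Variables (k : closedFieldType) (gT : finGroupType) (G : {group gT}) (n : nat).
Variable rG : mx_representation k G n.

Implicit Types (g h : gT) (f : {mpoly k[n]}) (v : 'cV[k]_n).

Definition evalv f v : k := f.@[fun i => v i 0].

Definition polyact g f : {mpoly k[n]} :=
  f \mPo [tuple \sum_(j < n) rG (g^-1)%g i j *: 'X_j | i < n].

Lemma evalv_polyact g f v :
  evalv (polyact g f) v = evalv f (rG (g^-1)%g *m v).
Proof.
rewrite /evalv /polyact comp_mpoly_meval; apply: meval_eq => i.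
rewrite tnth_mktuple mxE raddf_sum; apply: eq_bigr => j _ /=.
by rewrite mevalZ mevalXU.
Qed.

Definition invariants : set {mpoly k[n]} :=
  [set f | forall g, g \in G -> polyact g f = f].

(* [msize f] is the degree of f plus 1, and 0 for f = 0. *)
Definition invariants_le (d : nat) : set {mpoly k[n]} :=
  [set f | invariants f /\ (msize f <= d.+1)%N].

Definition plus_part (S : set {mpoly k[n]}) : set {mpoly k[n]} :=
  [set f | S f /\ f@_0%MM = 0].

Definition nullcone : set 'cV[k]_n :=
  [set v | forall f, plus_part invariants f -> evalv f v = 0].

Definition fixed_vectors : set 'cV[k]_n :=
  [set v | forall g, g \in G -> rG g *m v = v].

Definition is_delta_set (S : set {mpoly k[n]}) : Prop :=
  S `<=` invariants /\
  forall v, (fixed_vectors `\` nullcone) v ->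
    exists2 f, plus_part S f & evalv f v != 0.

Let orbit_prod (i : 'I_n) : {mpoly k[n]} := \prod_(g in G) polyact g 'X_i.

Let polyactX g i : polyact g 'X_i = \sum_(j < n) rG (g^-1)%g i j *: 'X_j.
Proof. by rewrite /polyact comp_mpolyXU -tnth_nth tnth_mktuple. Qed.

Let polyactMX g h i :
  g \in G -> h \in G -> polyact g (polyact h 'X_i) = polyact (g * h)%g 'X_i.
Proof.
move=> Gg Gh; rewrite polyactX {1}/polyact raddf_sum /=.
under eq_bigr do rewrite comp_mpolyZ -[_ \mPo _]/(polyact g _) polyactX scaler_sumr.
rewrite exchange_big polyactX /=; apply: eq_bigr => l _.
under eq_bigr do rewrite scalerA.
by rewrite -scaler_suml invMg repr_mxM ?groupV // mxE.
Qed.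

Let orbit_prod_inv i : invariants (orbit_prod i).
Proof.
move=> g Gg; rewrite /orbit_prod {1}/polyact rmorph_prod /=.
rewrite [RHS](reindex_inj (mulgI g)) /=.
under [RHS]eq_bigl do rewrite groupMl //.
by apply: eq_bigr => h Gh; exact: polyactMX.
Qed.

Let orbit_prod_homog i : orbit_prod i \is #|G|.-homog.
Proof.
rewrite /orbit_prod -sum1_card.
apply: (big_ind2 (fun (p : {mpoly k[n]}) d => p \is d.-homog)).
- exact: dhomog1.
- by move=> p d q e; exact: dhomogM.
move=> g _; rewrite polyactX; apply: rpred_sum => j _; apply: rpredZ.
by rewrite dhomogX /= mdeg1.
Qed.

Lemma is_delta_set_le_card : is_delta_set (invariants_le #|G|).
Proof.
split=> [f []//|v [vG vN]].
have [i vi] : exists i, v i 0 != 0.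
  apply: contrapT => v0; apply: vN => f [_ f0].
  have v0i i : v i 0 = 0.
    by apply/eqP/negPn/negP => vi; apply: v0; exists i.
  rewrite /evalv (meval_eq (v2 := fun=> 0)) // mevalE big1 // => m _.
  have [->|m0] := eqVneq m 0%MM; first by rewrite f0 mul0r.
  suff [j mj] : exists j, m j != 0%N by rewrite (bigD1 j) //= expr0n (negbTE mj) mul0r mulr0.
  apply: contrapT => m0'; case/eqP: m0; apply/mnmP => j; rewrite mnm0E.
  by apply/eqP/negPn/negP => mj; apply: m0'; exists j.
have hom := orbit_prod_homog i.
exists (orbit_prod i); first split; first split=> //.
- rewrite msizeE; apply/bigmax_leqP_seq => m m_supp _.
  by rewrite (dhomog_mf hom m_supp).
- by apply: (dhomog_nemf_coeff hom); rewrite /= mdeg0 eq_sym -lt0n cardG_gt0.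
rewrite /evalv rmorph_prod /=; apply/prodf_neq0 => g Gg.
rewrite -[meval _ _]/(evalv (polyact g 'X_i) v) evalv_polyact vG ?groupV //.
by rewrite /evalv mevalXU.
Qed.

Let is_delta_set_exists : exists d, `[< is_delta_set (invariants_le d) >].
Proof. by exists #|G|; apply/asboolP; exact: is_delta_set_le_card. Qed.

Definition delta_module : nat := ex_minn is_delta_set_exists.

Lemma delta_moduleP :
  is_delta_set (invariants_le delta_module) /\
  forall d, is_delta_set (invariants_le d) -> (delta_module <= d)%N.
Proof.
rewrite /delta_module; case: ex_minnP => d /asboolP dP dmin; split=> // e eP.
by apply: dmin; apply/asboolP.
Qed.

Lemma delta_module_le_card : (delta_module <= #|G|)%N.
Proof. by apply: (delta_moduleP).2; exact: is_delta_set_le_card. Qed.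

End Module.

Section Delta.
Variables (k : closedFieldType) (gT : finGroupType) (G : {group gT}).

Definition delta_values : set nat :=
  [set d | exists (n : nat) (rG : mx_representation k G n),
             d = delta_module rG].

(* [supremum 0%N A] is 0 when A is unbounded; [delta_supremums] shows that this
   does not occur here. *)
Definition delta : nat := supremum 0%N delta_values.

Lemma delta_supremums : supremums delta_values delta.
Proof.
have neq0 : delta_values !=set0.
  by exists (delta_module (regular_repr k G)), _, (regular_repr k G).
have sup_neq0 : supremums delta_values !=set0.
  apply: nat_supremums_neq0; exists #|G| => _ [n [rG ->]].
  exact: delta_module_le_card.
rewrite /delta /supremum; case: eqP => [e|_]; first by case: neq0; rewrite e.
exact: xgetPex.
Qed.

End Delta.

(* Main.v *)
Require Import Defs.
From mathcomp Require Import all_boot all_order all_algebra all_fingroup.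
From mathcomp Require Import all_solvable all_character.
From mathcomp Require Import boolp classical_sets.
From mathcomp Require Import mpoly.

(** Upper bound.  Let [v] be a nonzero fixed vector, say [v i 0 != 0].  For a
    left coset [C] of [P], the product [N_C] of the [x . 'X_i] over [x] in [C]
    is a form of degree [#|P|], and [g] in [G] sends [N_C] to [N_(gC)]; hence
    the sum of all [N_C] is a [G]-invariant.  As [v] is fixed, every [N_C] takes
    the value [(v i 0) ^+ #|P|] at [v], so the invariant takes this value times
    the index [#|G : P|], which is nonzero in [k] because [P] is a Sylow
    subgroup ([Sylow_separates_fixed]).

    Lower bound.  In the regular module, [G] permutes the coordinates, so the
    vector of ones is fixed, and the value there of a polynomial [f] is the sum
    of its coefficients.  If [f] is invariant, its coefficients are constant on
    the [P]-orbits of monomials, and a nontrivial orbit has cardinality zero in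
    [k]: only the monomials fixed by [P] count.  Since [P] acts freely on the
    variables, such a monomial has the same exponent along each set of [#|P|]
    variables forming an orbit, so that [#|P|] divides its degree.  Thus [f]
    cannot have zero constant term, degree less than [#|P|] and a nonzero value
    ([regular_invariant_degree]), and [delta_module] is exactly [#|P|] for the
    regular module ([delta_regular]). *)

Set Implicit Arguments.
Unset Strict Implicit.
Unset Printing Implicit Defensive.

Import fintype GRing.Theory.
Local Open Scope ring_scope.

(** * Sylow subgroups and the characteristic *)

Section Characteristic.

Variables (k : closedFieldType) (p : nat) (gT : finGroupType) (G P : {group gT}).
Hypotheses (hp : has_characteristic k p) (sylP : (p.-Sylow(G) P)%g).

Lemma Sylow_index_neq0 : #|G : P|%g%:R != 0 :> k.
Proof.
case: hp => [[p0 /pcharf0P ->]|pk]; first by rewrite -lt0n indexg_gt0.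
case/and3P: sylP => _ _ p'i.
by rewrite -(dvdn_pcharf pk) -p'natE // (pcharf_prime pk).
Qed.

(** This makes nontrivial [P]-orbits vanish in [k]; in characteristic zero it
    holds because [P] is trivial, which spares a separate treatment. *)
Lemma Sylow_divisor_eq0 d : (d %| #|P|)%N -> d != 1%N -> d%:R = 0 :> k.
Proof.
case: hp => [[p0 _]|pk] dP d1.
  by move: sylP; rewrite p0 pHall0 => /eqP P1; move: dP; rewrite P1 cards1 dvdn1 (negPf d1).
apply/eqP; rewrite -(dvdn_pcharf pk).
have: p.-nat d by apply: pnat_dvd dP _; case/and3P: sylP.
case/(p_natP)=> e de; move: d1; rewrite de; case: e {de} => // e _.
by rewrite expnS dvdn_mulr.
Qed.

End Characteristic.

(** * Sums over orbits *)

Section OrbitSums.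

Variables (aT : finGroupType) (D : {group aT}) (T : finType).
Variables (to : action D T) (P : {group aT}).
Hypothesis sPD : P \subset D.

Lemma big_orbits (V : nmodType) (F : T -> V) :
  \sum_x F x = \sum_(O in [set orbit to P x | x in [set: T]]) \sum_(x in O) F x.
Proof.
transitivity (\sum_(x in [set: T]) F x); first by apply: eq_bigl => x; rewrite inE.
apply: set_partition_big; apply: orbit_partition.
by apply/subsetP=> g Pg; rewrite !inE (subsetP sPD) //; apply/subsetP=> x; rewrite !inE.
Qed.

Lemma sum_orbit (V : nmodType) (F : T -> V) x :
    (forall y g, g \in P -> F (to y g) = F y) ->
  \sum_(y in orbit to P x) F y = F x *+ #|orbit to P x|.
Proof.
move=> Finv; rewrite -sumr_const; apply: eq_bigr => _ /orbitP[g Pg <-].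
exact: Finv.
Qed.

Lemma dvdn_card_orbit x : (#|orbit to P x| %| #|P|)%N.
Proof. by rewrite card_orbit_in // dvdn_indexg. Qed.

End OrbitSums.

(** * Action on monomials of bounded degree *)

Section MonomialAction.

Variables (aT : finGroupType) (D : {group aT}) (n d : nat) (to : action D 'I_n).

Lemma mdeg_perm_vars (m : 'X_{1..n < d}) g :
  (mdeg [multinom m (to i g^-1%g) | i < n] < d)%N.
Proof.
rewrite mdegE; under eq_bigr do rewrite mnmE.
suff <- : (\sum_i m i = \sum_i m (to i g^-1%g))%N by rewrite -mdegE bmdeg.
exact: reindex_inj (act_inj to g^-1%g).
Qed.

(** The exponents form a function on the variables, so a right action on the
    variables moves them through the inverse.  Bounding the degree makes the
    set of monomials finite, as orbit sums require. *)
Definition mnm_act m g : 'X_{1..n < d} := BMultinom (mdeg_perm_vars m g).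

Lemma mnm_actE m g i : mnm_act m g i = m (to i g^-1%g).
Proof. exact: mnmE. Qed.

Lemma mnm_act_is_action : is_action D mnm_act.
Proof.
split=> [g m1 m2 /(congr1 val)/mnmP eq_m|m g h Dg Dh]; apply/val_inj/mnmP => i.
  have [s _ sK] := injF_bij (act_inj to g^-1%g).
  by have := eq_m (s i); rewrite !mnm_actE sK.
by rewrite !mnm_actE invMg actMin ?groupV.
Qed.

Canonical mnm_action := Action mnm_act_is_action.

End MonomialAction.

(** * The regular module *)

Section RegularModule.

Variables (k : closedFieldType) (gT : finGroupType) (G : {group gT}).
Local Notation n := #|G|.

(** Right translation on the indices of the elements of [G].  Elements outside
    [G] act trivially because an action must be injective even off its
    domain. *)
Definition reg_act (i : 'I_n) g : 'I_n :=
  if (enum_val i * g)%g \in G then gring_index G (enum_val i * g)%g else i.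

Lemma enum_val_reg_act i g :
  g \in G -> enum_val (reg_act i g) = (enum_val i * g)%g.
Proof.
by move=> Gg; rewrite /reg_act groupMr // enum_valP gring_indexK // groupM ?enum_valP.
Qed.

Lemma reg_act_is_action : is_action G reg_act.
Proof.
split=> [g i j|i g h Gg Gh].
  have [Gg eq_ij|Gg] := boolP (g \in G); last first.
    by rewrite /reg_act !groupMl ?enum_valP ?(negPf Gg).
  apply: enum_val_inj; apply: (mulIg g).
  by rewrite -!enum_val_reg_act // eq_ij.
by apply: enum_val_inj; rewrite !enum_val_reg_act ?groupM // mulgA.
Qed.

Canonical reg_action := Action reg_act_is_action.

Lemma card_orbit_reg (P : {group gT}) i :
  P \subset G -> #|orbit reg_action P i| = #|P|.
Proof.
move=> sPG; apply: card_in_imset => g h Pg Ph /(congr1 enum_val).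
by rewrite !enum_val_reg_act ?(subsetP sPG) // => /mulgI.
Qed.

Local Notation rG := (regular_repr k G).

Lemma regular_mxE g i j : g \in G -> rG g i j = (j == reg_act i g)%:R.
Proof. by move=> Gg; rewrite !mxE /= /reg_act groupMr // enum_valP. Qed.

(** The coefficients of [msym] are known, so invariance becomes a condition on
    coefficients. *)
Lemma polyact_reg g f :
  g \in G -> polyact rG g f = msym (perm (act_inj reg_action g^-1%g)) f.
Proof.
move=> Gg; rewrite -[RHS]comp_mpoly_id msym_mPo /polyact; congr comp_mpoly.
apply: eq_from_tnth => i; rewrite !tnth_mktuple permE.
rewrite (bigD1 (reg_act i g^-1%g)) //= regular_mxE ?groupV // eqxx scale1r.
rewrite big1 ?addr0 // => j /negPf ji.
by rewrite regular_mxE ?groupV // ji scale0r.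
Qed.

Lemma mcoeff_reg_invariant d f g (m : 'X_{1..n < d}) :
  invariants rG f -> g \in G -> f@_(mnm_act reg_action m g) = f@_m.
Proof.
move=> finv Gg; rewrite -[in RHS](finv g Gg) polyact_reg // mcoeff_sym.
by congr mcoeff; apply/mnmP => i; rewrite mnm_actE mnmE permE.
Qed.

(** The exponents are constant on the [P]-orbits of variables, and all these
    orbits have [#|P|] elements because translation is free. *)
Lemma mdeg_fix_reg d (P : {group gT}) (m : 'X_{1..n < d}) :
  P \subset G -> (m \in 'Fix_(mnm_action d reg_action)(P))%g -> (#|P| %| mdeg m)%N.
Proof.
move=> sPG /afixP fixm; rewrite mdegE.
rewrite (big_orbits reg_action sPG).
apply: dvdn_sum => _ /imsetP[i _ ->].
rewrite sum_orbit ?card_orbit_reg //; first by rewrite -mulr_natr natn dvdn_mull.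
move=> j g Pg; rewrite -[in RHS](fixm g^-1%g) ?groupV //.
by rewrite mnm_actE invgK.
Qed.

Lemma fixed_const1 : fixed_vectors rG (const_mx 1).
Proof.
move=> g Gg; apply/matrixP => i j; rewrite !mxE (bigD1 (reg_act i g)) //=.
rewrite regular_mxE // eqxx !mxE mulr1 big1 ?addr0 // => l /negPf li.
by rewrite regular_mxE // li mul0r.
Qed.

Lemma evalv_const1 (f : {mpoly k[n]}) :
  evalv f (const_mx 1) = \sum_(m : 'X_{1..n < (msize f)}) f@_m.
Proof.
rewrite /evalv [in LHS](mpolywE (leqnn (msize f))) raddf_sum /=.
apply: eq_bigr => m _; rewrite mevalZ mevalX big1 ?mulr1 // => i _.
by rewrite mxE expr1n.
Qed.

End RegularModule.

(** The sum of the coefficients is computed orbit by orbit.  A monomial of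
    positive degree less than [#|P|] is not fixed by [P], so the cardinality of
    its orbit is a divisor of [#|P|] other than 1, which is zero in [k]. *)
Lemma regular_invariant_degree (k : closedFieldType) p (gT : finGroupType)
    (G P : {group gT}) (f : {mpoly k[#|G|]}) :
    has_characteristic k p -> (p.-Sylow(G) P)%g ->
    plus_part (invariants (regular_repr k G)) f ->
    evalv f (const_mx 1) != 0 -> (#|P| < msize f)%N.
Proof.
move=> hp sylP [finv f0]; apply: contraNT; rewrite -leqNgt => le_fP.
have sPG := pHall_sub sylP.
set to := mnm_action (msize f) (reg_action G).
rewrite evalv_const1 (big_orbits to sPG) big1 // => _ /imsetP[m _ ->].
rewrite sum_orbit; last first.
  by move=> m' g Pg; rewrite mcoeff_reg_invariant // (subsetP sPG).
have [m0|m_neq0] := eqVneq (bmnm m) 0%MM; first by rewrite m0 f0 mul0rn.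
rewrite -mulr_natr (Sylow_divisor_eq0 hp sylP) ?mulr0 //.
  exact: dvdn_card_orbit.
apply/eqP=> /eqP/cards1P[m' orb_m].
have fixm : (m \in 'Fix_to(P))%g.
  by apply/orbit1P; move: (orbit_refl to P m); rewrite orb_m => /set1P ->.
(* [m] has degree less than [msize f], hence less than [#|P|]. *)
have /dvdn_leq := mdeg_fix_reg sPG fixm.
rewrite lt0n mdeg_eq0 m_neq0 => /(_ isT) le_Pm.
by have := leq_trans (bmdeg m) le_fP; rewrite ltnNge le_Pm.
Qed.

(** * The transfer of an orbit product *)

Section Transfer.

Variables (k : closedFieldType) (gT : finGroupType) (G P : {group gT}) (n : nat).
Variables (rG : mx_representation k G n) (i : 'I_n).

Definition coset_prod (C : {set gT}) : {mpoly k[n]} :=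
  \prod_(x in C) polyact rG x 'X_i.

(** The relative transfer from [P] to [G] of the norm of ['X_i] over [P]; with
    one product per coset, no coset representatives have to be chosen. *)
Definition transfer_prod : {mpoly k[n]} :=
  \sum_(C in lcosets P G) coset_prod C.

Lemma polyactX g j : polyact rG g 'X_j = \sum_l rG (g^-1)%g j l *: 'X_l.
Proof. by rewrite /polyact comp_mpolyXU -tnth_nth tnth_mktuple. Qed.

Lemma polyactMX g h : g \in G -> h \in G ->
  polyact rG g (polyact rG h 'X_i) = polyact rG (g * h)%g 'X_i.
Proof.
move=> Gg Gh; rewrite polyactX {1}/polyact raddf_sum /=.
under eq_bigr do rewrite comp_mpolyZ -[_ \mPo _]/(polyact rG g _) polyactX scaler_sumr.
rewrite exchange_big polyactX /=; apply: eq_bigr => l _.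
under eq_bigr do rewrite scalerA.
by rewrite -scaler_suml invMg repr_mxM ?groupV // mxE.
Qed.

Lemma polyact_coset_prod g (C : {set gT}) : g \in G -> C \subset G ->
  polyact rG g (coset_prod C) = coset_prod (g *: C)%g.
Proof.
move=> Gg sCG; rewrite /coset_prod {1}/polyact rmorph_prod /=.
rewrite [RHS](reindex_inj (mulgI g)) /=.
under [RHS]eq_bigl do rewrite mem_lcoset mulKg.
by apply: eq_bigr => x Cx; apply: polyactMX => //; apply: (subsetP sCG).
Qed.

Hypothesis sPG : P \subset G.

Lemma lcosets_sub (C : {set gT}) : C \in lcosets P G -> C \subset G.
Proof. by case/lcosetsP=> x Gx ->; apply: mul_subG; rewrite ?finset.sub1set. Qed.

Lemma transfer_prod_invariant : invariants rG transfer_prod.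
Proof.
move=> g Gg; rewrite /transfer_prod {1}/polyact rmorph_sum /=.
have lcosetM h (C : {set gT}) :
    h \in G -> C \in lcosets P G -> (h *: C)%g \in lcosets P G.
  move=> Gh /lcosetsP[x Gx ->]; apply/lcosetsP.
  by exists (h * x)%g; rewrite ?groupM // lcosetM.
have gK : cancel (fun C : {set gT} => g *: C)%g (fun C => g^-1 *: C)%g.
  exact: lcosetK.
rewrite [RHS](reindex_inj (can_inj gK)) /=.
apply: eq_big => [C|C PC]; last by apply: polyact_coset_prod (lcosets_sub PC).
apply/idP/idP; first exact: lcosetM.
by rewrite -{2}[C]gK; apply: lcosetM; rewrite groupV.
Qed.

Lemma polyact_homog g : polyact rG g 'X_i \is 1.-homog.
Proof.
rewrite polyactX; apply: rpred_sum => j _; apply: rpredZ.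
by rewrite dhomogX /= mdeg1.
Qed.

Lemma transfer_prod_homog : transfer_prod \is #|P|.-homog.
Proof.
apply: rpred_sum => _ /lcosetsP[x _ ->]; rewrite -(card_lcoset P x) -sum1_card.
apply: (big_ind2 (fun (q : {mpoly k[n]}) d => q \is d.-homog)).
- exact: dhomog1.
- by move=> q d q' d'; apply: dhomogM.
- by move=> g _; apply: polyact_homog.
Qed.

(** At a fixed vector every linear form [g . 'X_i] takes the value of ['X_i]. *)
Lemma evalv_transfer_prod v : fixed_vectors rG v ->
  evalv transfer_prod v = v i 0 ^+ #|P| *+ #|G : P|%g.
Proof.
move=> vG; rewrite /evalv raddf_sum /= -card_lcosets -sumr_const.
apply: eq_bigr => C PC; rewrite rmorph_prod /=.
have [x _ defC] := lcosetsP PC.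
rewrite -(card_lcoset P x) -defC -prodr_const; apply: eq_bigr => g Cg.
rewrite -[meval _ _]/(evalv (polyact rG g 'X_i) v) evalv_polyact vG.
  by rewrite /evalv mevalXU.
by rewrite groupV (subsetP (lcosets_sub PC)).
Qed.

End Transfer.

(** * Separating fixed vectors from zero *)

Lemma Sylow_separates_fixed (k : closedFieldType) p (gT : finGroupType)
    (G P : {group gT}) n (rG : mx_representation k G n) (v : 'cV[k]_n) :
    has_characteristic k p -> (p.-Sylow(G) P)%g ->
    fixed_vectors rG v -> v != 0 ->
  exists2 f, plus_part (invariants_le rG #|P|) f & evalv f v != 0.
Proof.
move=> hp sylP vG; case/cV0Pn=> i vi.
have sPG := pHall_sub sylP; have hom := transfer_prod_homog P rG i.
exists (transfer_prod P rG i).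
  split; first split.
  - exact: transfer_prod_invariant.
  - rewrite msizeE; apply/bigmax_leqP_seq => m m_supp _.
    by rewrite (dhomog_mf hom m_supp).
  - by apply: (dhomog_nemf_coeff hom); rewrite /= mdeg0 eq_sym -lt0n cardG_gt0.
rewrite evalv_transfer_prod // -mulr_natr mulf_neq0 ?expf_neq0 //.
exact: Sylow_index_neq0 sylP.
Qed.

Lemma evalv0 (k : closedFieldType) n (f : {mpoly k[n]}) : evalv f 0 = f@_0%MM.
Proof.
rewrite /evalv; elim/mpolyind: f => [|c m f _ _ IHf]; first by rewrite meval0 mcoeff0.
rewrite mevalD mevalZ mevalX mcoeffD mcoeffZ mcoeffX -IHf; congr (_ * _ + _).
have [->|m0] := eqVneq m 0%MM; first by rewrite big1 // => i _; rewrite mnm0E.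
have /existsP[i mi]: [exists i, m i != 0%N].
  apply: contraNT m0; rewrite negb_exists => /forallP m0; apply/eqP/mnmP => i.
  by rewrite mnm0E; apply/eqP/negPn/m0.
by rewrite (bigD1 i) //= mxE expr0n (negPf mi) mul0r.
Qed.

Lemma Sylow_is_delta_set (k : closedFieldType) p (gT : finGroupType)
    (G P : {group gT}) n (rG : mx_representation k G n) :
    has_characteristic k p -> (p.-Sylow(G) P)%g ->
  is_delta_set rG (invariants_le rG #|P|).
Proof.
move=> hp sylP; split=> [f []//|v [vG vN]].
apply: Sylow_separates_fixed hp sylP vG _; apply/eqP => v0; apply: vN => f [_ f0].
by rewrite v0 evalv0.
Qed.

(** The vector of ones lies outside the nullcone because the invariant from the
    upper bound already separates it from zero; the bound on invariant degrees
    then applies to any invariant without constant term that does not vanish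
    there. *)
Lemma delta_regular (k : closedFieldType) p (gT : finGroupType)
    (G P : {group gT}) :
    has_characteristic k p -> (p.-Sylow(G) P)%g ->
  delta_module (regular_repr k G) = #|P|.
Proof.
move=> hp sylP; have [deltaP delta_min] := delta_moduleP (regular_repr k G).
apply/eqP; rewrite eqn_leq delta_min /=; last exact: Sylow_is_delta_set hp sylP.
have fix1 := @fixed_const1 k gT G.
have [|f [[finv le_f] f0] fv] := deltaP.2 (const_mx 1).
  split=> // null1; have [|f [[finv _] f0]] := Sylow_separates_fixed hp sylP fix1.
    by apply/cV0Pn; exists (gring_index G 1%g); rewrite mxE oner_neq0.
  by rewrite null1 ?eqxx.
by rewrite -ltnS (leq_trans _ le_f) // (regular_invariant_degree hp sylP).
Qed.

Theorem theorem1p1 (k : closedFieldType) (p : nat) (hp : has_characteristic k p)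
    (gT : finGroupType) (G P : {group gT}) (hP : (p.-Sylow(G) P)%g) :
  delta k G = #|P|.
Proof.
have [ub_delta lub_delta] := delta_supremums k G.
apply/eqP; rewrite eqn_leq; apply/andP; split.
  apply: lub_delta => _ [n [rG ->]].
  by apply: (delta_moduleP rG).2; apply: Sylow_is_delta_set hp hP.
apply: ub_delta; exists #|G|, (regular_repr k G).
by rewrite (delta_regular hp hP).
Qed.
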